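(* Let $<_t$ be a term order on $\binom{[n]}{2}$ such that $\{a,b\}<_t\{a',b'\}$ whenever $a+b<a'+b'$. Let $G$ be a graph on $[n]$ such that every $3$-subset of $[n]$ contains an edge of $G$. Then the exterior shifting $E(G)^{<_t}$ contains $B(n)=\{\{a,b\}:1\le a<b\le n,\ a+b\le n\}$.
   Context: Partial order on $k$-subsets of $[n]$: for $S=\{s_1<\dots<s_k\}$, $T=\{t_1<\dots<t_k\}$, $S\le T$ iff $s_i\le t_i$ for all $i$. A term order on $\binom{[n]}{k}$ is a linear order extending this partial order. Let $X=(x_{ij})$ be an $n\times n$ matrix of independent indeterminates over $\mathbb{Q}$ and $C_k(X)$ its $k$-th compound matrix (entries $c_{S,T}=\det(x_{ij})_{i\in S,j\in T}$ for $k$-subsets $S,T$). For $\mathcal F\subseteq\binom{[n]}{k}$, the exterior shifting $\mathcal F^{<_t}$ is obtained greedily: go through all $S\in\binom{[n]}{k}$ in increasing $<_t$ order and put $S$ into $\mathcal F^{<_t}$ iff the row of $C_k(X)$ indexed by $S$, restricted to the columns indexed by $\mathcal F$, is linearly independent (over $\mathbb{Q}(x_{ij})$) of the previously selected such rows. Thus $|\mathcal F^{<_t}|=|\mathcal F|$. *)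

(* Defs.v *)
From HB Require Import structures.
From mathcomp Require Import all_boot all_order all_algebra fraction.
Set Implicit Arguments. Unset Strict Implicit. Unset Printing Implicit Defensive.
Import Order.TTheory GRing.Theory Num.Theory.
Local Open Scope ring_scope.

Fixpoint mpoly (m : nat) : idomainType :=
  match m with
  | 0 => rat
  | m'.+1 => ({poly mpoly m'} : idomainType)
  end.

Fixpoint mvar (m : nat) : nat -> mpoly m :=
  match m return nat -> mpoly m with
  | 0 => fun _ => 0
  | m'.+1 => fun k => if k == m' then ('X : {poly mpoly m'}) else (mvar m' k)%:P
  end.

Definition ratfun (n : nat) : fieldType := {fraction (mpoly (n * n))}.

Definition xvar (n i j : nat) : ratfun n := @FracField.tofrac (mpoly (n * n)) (mvar (n * n) (i * n + j)).

(* Elements of a subset in increasing order, as nats. *)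
Definition elems n (S : {set 'I_n}) : seq nat := [seq val i | i <- enum S].

Definition compound_entry (n k : nat) (S T : {set 'I_n}) : ratfun n :=
  \det (\matrix_(a < k, b < k) xvar n (nth 0%N (elems S) a) (nth 0%N (elems T) b)).

Definition gale_le n k (S T : {set 'I_n}) : Prop :=
  forall i, (i < k)%N -> (nth 0%N (elems S) i <= nth 0%N (elems T) i)%N.

Definition ksubset n k (S : {set 'I_n}) : bool := #|S| == k.

Definition term_order n k (le : rel {set 'I_n}) : Prop :=
  [/\ (forall S, ksubset k S -> le S S),
      (forall S T, ksubset k S -> ksubset k T -> le S T || le T S),
      (forall S T, ksubset k S -> ksubset k T -> le S T -> le T S -> S = T),
      (forall S T U, ksubset k S -> ksubset k T -> ksubset k U ->
                       le S T -> le T U -> le S U) &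
      (forall S T, ksubset k S -> ksubset k T -> gale_le k S T -> le S T)].

Definition ksubsets n k : seq {set 'I_n} := [seq S <- enum {set 'I_n} | ksubset k S].

(* Row of C_k(X) indexed by S, restricted to the columns indexed by Fam
   (columns outside Fam are replaced by zero; columns are indexed by all subsets). *)
Definition crow n k (Fam : {set {set 'I_n}}) (S : {set 'I_n})
  : 'rV[ratfun n]_(#|{: {set 'I_n}}|) :=
  \row_j (let T := enum_val j in if T \in Fam then compound_entry k S T else 0).

Definition ext_shift n k (le : rel {set 'I_n}) (Fam : {set {set 'I_n}})
  : {set {set 'I_n}} :=
  let sel := foldl (fun acc S =>
       if (crow k Fam S <= \sum_(T <- acc) <<crow k Fam T>>)%MS then acc
       else rcons acc S) [::] (sort le (ksubsets n k)) in
  [set S in sel].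

(* B(n) = {{a,b} : 1 <= a < b <= n, a+b <= n}, shifted to 0-indexed ordinals. *)
Definition Bset n : {set {set 'I_n}} :=
  [set S : {set 'I_n} | [exists a : 'I_n, exists b : 'I_n,
     [&& (a < b)%N, (a.+1 + b.+1 <= n)%N & S == [set a; b]]]].

(* Main.v *)
(* The rows of the compound matrix indexed by B(n) come first in the term order,
   so it suffices that, restricted to the columns in G, they are independent; and
   for that it suffices to find one rational specialisation f of the columns of X
   for which they are.  Independence at f means: an alternating form L with
   L(e_a, e_b) = 0 for a + b > n that vanishes on f(k) /\ f(l) for every edge kl
   is zero.  Build f by induction, removing two vertices i, j such that every
   other vertex k is adjacent to i or j: shift the frame of the remaining n - 2
   vertices to the coordinates 2, ..., n - 1 and put f(i) = e_1, f(j) = e_1 + e_n.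
   Since e_n is in the radical of L, both f(i) and f(j) pair with f(k) as e_1 does; hence L(e_1, f(k)) = 0 for all k, so e_1 is in
   the radical, and the rest of L is zero by induction. *)
Require Import Defs.
From HB Require Import structures.
From mathcomp Require Import all_boot all_order all_algebra fraction.
From mathcomp Require Import zify ring.

Set Implicit Arguments. Unset Strict Implicit. Unset Printing Implicit Defensive.
Import Order.TTheory GRing.Theory Num.Theory.
Local Open Scope ring_scope.

(** * Frames on which alternating forms are detected by the edges *)

Section Frame.
Variable F : fieldType.

Definition dotn (n : nat) (x y : nat -> F) : F := \sum_(a < n) x a * y a.

(** The two arguments are contracted by nested [dotn]s, so that the [dotn_extend] lemmas apply to
    each in turn. *)
Definition bilin (n : nat) (L : nat -> nat -> F) (x y : nat -> F) : F :=
  dotn n (fun a => dotn n (L a) y) x.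

Definition alternating (L : nat -> nat -> F) : Prop :=
  (forall a, L a a = 0) /\ (forall a b, L a b = - L b a).

Lemma dotn0 (n : nat) (x y : nat -> F) :
  (forall a, (a < n)%N -> x a = 0) -> dotn n x y = 0.
Proof. by move=> x0; apply: big1 => a _; rewrite x0 ?mul0r. Qed.

Lemma bilinC (n : nat) (L : nat -> nat -> F) (x y : nat -> F) :
  alternating L -> bilin n L x y = - bilin n L y x.
Proof.
case=> _ Lanti; rewrite /bilin /dotn -sumrN.
under eq_bigr => a _ do rewrite mulr_suml.
rewrite exchange_big /=; apply: eq_bigr => b _.
rewrite mulr_suml -sumrN; apply: eq_bigr => a _.
by rewrite (Lanti a b) !mulNr mulrAC.
Qed.

Section Extend.
Variables (I : eqType) (i j : I) (m : nat) (f : I -> nat -> F).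
Hypothesis neq_ij : i != j.

Definition extend (k : I) (a : nat) : F :=
  if k == i then (a == 0)%N%:R
  else if k == j then (a == 0)%N%:R + (a == m.+1)%:R
  else if (0 < a < m.+1)%N then f k a.-1 else 0.

Lemma dotn_extend_i (x : nat -> F) : dotn m.+2 x (extend i) = x 0%N.
Proof.
rewrite /dotn /extend eqxx big_ord_recl mulr1 big1 ?addr0 // => a _.
by rewrite mulr0.
Qed.

Lemma dotn_extend_j (x : nat -> F) : dotn m.+2 x (extend j) = x 0%N + x m.+1.
Proof.
rewrite /dotn /extend eqxx eq_sym (negPf neq_ij) big_ord_recl big_ord_recr /=.
rewrite big1 => [|a _].
  by rewrite /bump /= !add1n eqxx /= !addr0 !add0r !mulr1.
by rewrite /bump /= !add1n add0r eqSS (ltn_eqF (ltn_ord a)) mulr0.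
Qed.

Lemma dotn_extend (x : nat -> F) (k : I) :
  k != i -> k != j -> dotn m.+2 x (extend k) = dotn m (x \o succn) (f k).
Proof.
rewrite /dotn /extend => /negPf-> /negPf->.
rewrite big_ord_recl big_ord_recr /= /bump /= !add1n ltnn !mulr0 add0r addr0.
by apply: eq_bigr => a _; rewrite /bump /= add1n ltnS ltn_ord.
Qed.

End Extend.

Lemma eq_dotn n x x' y : (forall a, (a < n)%N -> x a = x' a) ->
  dotn n x y = dotn n x' y.
Proof. by move=> e; apply: eq_bigr => a _; rewrite e. Qed.

(** The statement ranges over vertex subsets [A] so that two vertices can be removed. The spanning
    clause is carried along because the form clause uses it to pass from [L(e_1, f k) = 0] for all
    [k] to the vanishing of the row [L 0]. Coordinates are 0-based, whence the successors in
    [a.+1 + b.+1]. *)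
Lemma exists_frame (I : finType) (e : rel I) (A : {set I}) (n : nat) :
  #|A| = n -> symmetric e ->
  (forall i j k, i \in A -> j \in A -> k \in A -> i != j -> i != k -> j != k ->
     [|| e i j, e i k | e j k]) ->
  exists f : I -> nat -> F,
    (forall x, (forall k, k \in A -> dotn n x (f k) = 0) ->
       forall a, (a < n)%N -> x a = 0) /\
    (forall L, alternating L -> (forall a b, (n < a.+1 + b.+1)%N -> L a b = 0) ->
       (forall k l, k \in A -> l \in A -> e k l -> bilin n L (f k) (f l) = 0) ->
       forall a b, L a b = 0).
Proof.
elim/ltn_ind: n A => n IH A cardA e_sym tri.
case: n IH cardA => [|[|m]] IH cardA.
- by exists (fun _ _ => 0); split=> // L _ L0 _ a b; apply: L0.
- have /cards1P[i A1] : #|A| == 1%N by rewrite cardA.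
  exists (fun _ _ => 1); split=> [x x0 a|L _ L0 _ a b]; last by apply: L0; lia.
  rewrite ltnS leqn0 => /eqP->.
  have := x0 i; rewrite A1 inE eqxx => /(_ isT).
  by rewrite /dotn big_ord1 mulr1.
(* A non-adjacent pair works by the triple condition; if there is none, any two vertices of [A]
   work. *)
have [i [j [iA jA neq_ij ij]]] : exists i j, [/\ i \in A, j \in A, i != j &
    forall k, k \in A -> k != i -> k != j -> e i k || e j k].
  have [[i j] /and4P[/= iA jA neq_ij nij]|all_e] :=
      pickP (fun p => [&& p.1 \in A, p.2 \in A, p.1 != p.2 & ~~ e p.1 p.2]).
    exists i, j; split=> // k kA ki kj.
    have := tri i j k iA jA kA neq_ij; rewrite (negPf nij) /=.
    by apply; rewrite eq_sym.
  have /card_gt1P[i [j [iA jA neq_ij]]] : (1 < #|A|)%N by rewrite cardA.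
  exists i, j; split=> // k kA ki kj; have := all_e (i, k).
  by rewrite /= iA kA eq_sym ki /= => /negbFE->.
pose A' := A :\ i :\ j.
have A'P k : k \in A' -> [/\ k \in A, k != i & k != j].
  by rewrite !inE => /and3P[].
have cardA' : #|A'| = m.
  have := cardsD1 j (A :\ i); rewrite !inE jA eq_sym neq_ij /= -/A'.
  have := cardsD1 i A; rewrite iA cardA; lia.
have [||f [f_span f_form]] := IH m _ A' cardA' e_sym; first by lia.
  by move=> k l p /A'P[? _ _] /A'P[? _ _] /A'P[? _ _]; apply: tri.
exists (extend i j m f); split=> [x x0|L L_alt L0 Le].
  have xi := x0 _ iA; rewrite dotn_extend_i in xi.
  have xj := x0 _ jA; rewrite dotn_extend_j // xi add0r in xj.
  case=> [//|a]; rewrite ltnS leq_eqVlt => /orP[/eqP[->] //|]; rewrite ltnS => a_lt.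
  apply: (f_span (x \o succn)) => // k /A'P[kA ki kj].
  by rewrite -(@dotn_extend _ i j) // x0.
have Lend x : dotn m.+2 (L m.+1) x = 0.
  by apply: dotn0 => b _; apply: L0; lia.
have Le0 k : k \in A' -> dotn m (L 0%N \o succn) (f k) = 0.
  case/A'P=> kA ki kj; rewrite -(@dotn_extend _ i j) //.
  have /orP[/(Le _ _ iA kA)|/(Le _ _ jA kA)] := ij k kA ki kj.
    by rewrite /bilin dotn_extend_i.
  by rewrite /bilin dotn_extend_j // Lend addr0.
case: (L_alt) => Ldiag Lanti.
have L0a a : L 0%N a = 0.
  case: a => [//|a].
  have [a_lt|a_ge] := ltnP a m; first exact: (f_span (L 0%N \o succn)).
  by apply: L0; lia.
(* Shifting both indices raises their sum by two, which matches the drop of the bound from [m.+2] to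
   [m]. *)
have LSS : forall a b, L a.+1 b.+1 = 0.
  apply: (f_form (fun a b => L a.+1 b.+1)) => [|a b ab|k l kA' lA' kl].
  - by split=> [a|a b]; [apply: Ldiag|apply: Lanti].
  - by apply: L0; lia.
  have [kA ki kj] := A'P _ kA'; have [lA li lj] := A'P _ lA'.
  have := Le _ _ kA lA kl; rewrite /bilin dotn_extend // => <-.
  by apply: eq_dotn => a _; rewrite /= dotn_extend.
case=> [|a] [|b]; rewrite ?L0a ?LSS //.
by rewrite Lanti L0a oppr0.
Qed.

End Frame.

(** * Specialisation of the indeterminates *)

(** Variables are evaluated one at a time, along the iterated construction of [mpoly]; for [k >= m],
    [mvar m k] is 0. *)
Lemma mpoly_eval_exists (m : nat) (v : nat -> rat) :
  exists phi : {rmorphism mpoly m -> rat},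
    forall k, (k < m)%N -> phi (mvar m k) = v k.
Proof.
elim: m => [|m [phi phiE]]; first by exists (idfun : {rmorphism rat -> rat}).
exists (horner_eval (v m) \o map_poly phi : {rmorphism {poly mpoly m} -> rat}).
move=> k; rewrite /= ltnS leq_eqVlt.
have [->|neq_km] /= := eqVneq k m; first by rewrite map_polyX /horner_eval hornerX.
by move=> lt_km; rewrite map_polyC /horner_eval hornerC /= phiE.
Qed.

(** A maximal minor that is nonzero after [phi] was nonzero in [D], and stays nonzero in the
    fraction field. Transposes appear because [rowsub] selects rows, while here columns are
    selected. *)
Lemma row_free_specialize (D : idomainType) (F : fieldType) (phi : {rmorphism D -> F})
    (m p : nat) (P : 'M[D]_(m, p)) :
  row_free (map_mx phi P) -> row_free (map_mx (@FracField.tofrac D) P).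
Proof.
set N := map_mx phi P => freeN.
have fullT : row_full N^T by rewrite /row_full mxrank_tr.
have := fullrowsub_unit fullT; set g := fullrankfun fullT.
have -> : rowsub g N^T = map_mx phi (rowsub g P^T) by apply/matrixP=> a b; rewrite !mxE.
rewrite unitmxE det_map_mx unitfE => detN.
have detP : \det (rowsub g P^T) != 0 by apply: contra_neq detN => ->; rewrite rmorph0.
have /mxrank_unit rk : map_mx (@FracField.tofrac D) (rowsub g P^T) \in unitmx.
  by rewrite unitmxE det_map_mx unitfE tofrac_eq0.
rewrite -row_leq_rank -mxrank_tr -{1}rk.
have -> : map_mx (@FracField.tofrac D) (rowsub g P^T)
          = rowsub g (map_mx (@FracField.tofrac D) P)^T.
  by apply/matrixP=> a b; rewrite !mxE.
exact/mxrankS/rowsub_sub.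
Qed.

(** * Pairs, their minors, and greedy selection *)

Lemma elems_pair (n : nat) (a b : 'I_n) :
  (a < b)%N -> elems [set a; b] = [:: val a; val b].
Proof.
move=> ab; apply: (@irr_sorted_eq _ ltn) => //.
- exact: ltn_trans.
- by move=> x; rewrite /= ltnn.
- have sub : subseq (elems [set a; b]) (iota 0 n).
    by rewrite -val_enum_ord /elems map_subseq // {1}/enum_mem -enumT filter_subseq.
  exact: (subseq_sorted ltn_trans sub (iota_ltn_sorted 0 n)).
- by rewrite /= andbT.
move=> x; apply/mapP/idP => [[i]|].
  by rewrite mem_enum !inE => /orP[] /eqP-> -> /=; rewrite eqxx ?orbT.
rewrite !inE => /orP[] /eqP->; [exists a | exists b] => //.
  by rewrite mem_enum !inE eqxx.
by rewrite mem_enum !inE eqxx orbT.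
Qed.

Lemma card2_ltn (n : nat) (S : {set 'I_n}) :
  #|S| = 2%N -> exists a b : 'I_n, (a < b)%N /\ S = [set a; b].
Proof.
move/eqP/cards2P=> [a [b [neq_ab ->]]].
have : (a != b :> nat) by [].
rewrite neq_ltn => /orP[ab|ba]; first by exists a, b.
by exists b, a; rewrite setUC.
Qed.

Lemma compound_entry2 (n : nat) (a b c d : 'I_n) : (a < b)%N -> (c < d)%N ->
  compound_entry 2 [set a; b] [set c; d]
  = xvar n a c * xvar n b d - xvar n a d * xvar n b c.
Proof.
move=> ab cd; rewrite /compound_entry !elems_pair //.
rewrite (expand_det_row _ 0) !big_ord_recl big_ord0 addr0 /cofactor !det_mx11 !mxE /=.
by rewrite expr0 expr1 mul1r mulN1r mulrN.
Qed.

Lemma BsetP (n : nat) (S : {set 'I_n}) :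
  reflect (exists a b : 'I_n, [/\ (a < b)%N, (a.+1 + b.+1 <= n)%N & S = [set a; b]])
          (S \in Bset n).
Proof.
rewrite inE; apply: (iffP existsP) => [[a /existsP[b /and3P[ab abn /eqP->]]]|].
  by exists a, b.
by case=> a [b [ab abn ->]]; exists a; apply/existsP; exists b; rewrite ab abn eqxx.
Qed.

(* A vector killing every row of M but the i-th separates that row from the others. *)
Lemma row_free_sub_sum (F : fieldType) (m p : nat) (M : 'M[F]_(m, p))
    (I : Type) (i : 'I_m) (s : seq I) (r : I -> 'rV[F]_p) :
  row_free M -> all (fun k => [exists j : 'I_m, (j != i) && (r k == row j M)]) s ->
  ~~ (row i M <= \sum_(k <- s) <<r k>>)%MS.
Proof.
move=> freeM all_s; apply/negP=> sub_i.
have Mw : M *m col i (pinvmx M) = col i 1%:M by rewrite !colE mulmxA mulmxVp.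
have rowMw j : row j M *m col i (pinvmx M) = (j == i)%:R%:M.
  by rewrite -row_mul Mw; apply/matrixP=> a b; rewrite !ord1 !mxE mulr1n.
have : (\sum_(k <- s) <<r k>> <= kermx (col i (pinvmx M)))%MS.
  elim: s all_s {sub_i} => [|k s IHs] /=; first by rewrite big_nil sub0mx.
  case/andP=> /existsP[j /andP[neq_ji /eqP rk]] /IHs sub_s.
  rewrite big_cons addsmx_sub sub_s andbT genmxE rk.
  by apply/sub_kermxP; rewrite rowMw (negPf neq_ji) raddf0.
move/(submx_trans sub_i)/sub_kermxP/matrixP/(_ 0 0).
by rewrite rowMw eqxx !mxE => /eqP; rewrite oner_eq0.
Qed.

(** When the fold reaches [x], its accumulator is a subsequence of the elements preceding [x];
    afterwards it only grows. *)
Lemma foldl_select_mem (T : eqType) (skip : seq T -> T -> bool) (s : seq T) (x : T) :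
  x \in s ->
  (forall acc, subseq acc (take (index x s) s) -> ~~ skip acc x) ->
  x \in foldl (fun acc y => if skip acc y then acc else rcons acc y) [::] s.
Proof.
set step := fun acc y => _.
move=> x_s noskip.
have sub_foldl acc t : exists2 u, foldl step acc t = acc ++ u & subseq u t.
  elim: t acc => [|y t IHt] acc /=; first by exists [::]; rewrite ?cats0.
  have [u -> sub_u] := IHt (step acc y); rewrite /step.
  case: ifP => _; first by exists u => //; apply: subseq_trans sub_u (subseq_cons _ _).
  by exists (y :: u); rewrite ?cat_rcons //= eqxx.
rewrite -(cat_take_drop (index x s) s) foldl_cat drop_index //=.
have [u uE sub_u] := sub_foldl [::] (take (index x s) s).
rewrite uE /= {2}/step (negPf (noskip _ sub_u)).
have [v -> _] := sub_foldl (rcons u x) (drop (index x s).+1 s).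
by rewrite mem_cat mem_rcons mem_head.
Qed.

(** * Independence of the rows indexed by B(n) *)

Section Generic.
Variables (n : nat) (G : {set {set 'I_n}}).
Hypothesis (HG : forall e, e \in G -> #|e| = 2%N).
Hypothesis (H3 : forall T : {set 'I_n}, #|T| = 3%N -> exists2 e, e \in G & e \subset T).

Lemma adjacent_in_triple (i j k : 'I_n) : i != j -> i != k -> j != k ->
  [|| [set i; j] \in G, [set i; k] \in G | [set j; k] \in G].
Proof.
move=> ij ik jk.
have card3 : #|[set i; j; k]| = 3%N.
  by rewrite setUC cardsU1 !inE cards2 ij negb_or eq_sym ik eq_sym jk.
have [e eG sub_e] := H3 card3.
have [a [b [ab eE]]] := card2_ltn (HG eG).
have neq_ab : a != b by rewrite -val_eqE neq_ltn ab.
move: sub_e neq_ab eG {ab}; rewrite eE subUset !sub1set !inE -!orbA.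
case/andP=> /or3P[] /eqP-> /or3P[] /eqP->; rewrite ?eqxx // => _ eG;
  move: (eG); rewrite setUC => eG'; by rewrite ?eG ?eG' ?orbT.
Qed.

Let lo (S : {set 'I_n}) := nth 0%N (elems S) 0.
Let hi (S : {set 'I_n}) := nth 0%N (elems S) 1.

(** The ring is a parameter so that one formula serves over the rationals, the polynomials and their
    fractions. *)
Definition minor (R : pzRingType) (x : nat -> nat -> R) (S T : {set 'I_n}) : R :=
  x (lo S) (lo T) * x (hi S) (hi T) - x (lo S) (hi T) * x (hi S) (lo T).

Definition minors (R : pzRingType) (x : nat -> nat -> R)
  : 'M[R]_(#|Bset n|, #|{: {set 'I_n}}|) :=
  \matrix_(i, j) let T := enum_val j in
                 if T \in G then minor x (enum_val i) T else 0.

Lemma crow_minors (i : 'I_#|Bset n|) :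
  crow 2 G (enum_val i) = row i (minors (xvar n)).
Proof.
apply/rowP=> j; rewrite !mxE /=.
case: (boolP (enum_val j \in G)) => // /HG/card2_ltn[c [d [cd ->]]].
have /BsetP[a [b [ab _ ->]]] := enum_valP i.
by rewrite compound_entry2 // /minor /lo /hi !elems_pair.
Qed.

Lemma sum_delta (R : pzRingType) (k : nat) (z : nat -> R) :
  (k < n)%N -> \sum_(b < n) (b == k :> nat)%:R * z b = z k.
Proof.
move=> kn; rewrite (bigD1 (Ordinal kn)) //= eqxx mul1r big1 ?addr0 // => b neq_b.
by rewrite -val_eqE /= in neq_b; rewrite (negPf neq_b) mul0r.
Qed.

Lemma lo_hi_Bset (S : {set 'I_n}) : S \in Bset n ->
  [/\ (lo S < hi S)%N, (hi S < n)%N & ((lo S).+1 + (hi S).+1 <= n)%N].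
Proof.
by case/BsetP=> [a [b [ab abn ->]]]; rewrite /lo /hi elems_pair //= ltn_ord.
Qed.

Lemma lo_hi_inj : {in Bset n &, forall S T, lo S = lo T -> hi S = hi T -> S = T}.
Proof.
move=> _ _ /BsetP[a [b [ab _ ->]]] /BsetP[c [d [cd _ ->]]].
by rewrite /lo /hi !elems_pair //= => /val_inj-> /val_inj->.
Qed.

(** A linear relation [u] between the rows is read as the alternating form with coefficient [u_S] at
    the pair [S]. The relation in column [kl] says that this form vanishes on [f k] and [f l], so
    the frame forces it to be zero. *)
Lemma row_free_minors_rat : exists x : nat -> nat -> rat, row_free (minors x).
Proof.
have [|||f [_ f_form]] := @exists_frame rat _ (fun i j : 'I_n => [set i; j] \in G) setT n.
- by rewrite cardsT card_ord.
- by move=> i j; rewrite setUC.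
- by move=> i j k _ _ _; apply: adjacent_in_triple.
(* Column [v] is the frame vector of vertex [v]; 0 fills the columns out of range. *)
exists (fun a v => if insub v is Some i then f i a else 0).
set x := fun a v => _; apply: inj_row_free => u uM0.
have xE a (i : 'I_n) : x a i = f i a by rewrite /x valK.
pose l (i : 'I_#|Bset n|) := lo (enum_val i); pose h (i : 'I_#|Bset n|) := hi (enum_val i).
have lhP i := lo_hi_Bset (enum_valP i).
pose L a b := \sum_i u 0 i * ((b == h i)%:R * (a == l i)%:R - (b == l i)%:R * (a == h i)%:R).
have L_alt : alternating L.
  split=> [a|a b]; rewrite /L.
    by apply: big1 => i _; rewrite mulrC [X in X - _]mulrC subrr mul0r.
  by rewrite -sumrN; apply: eq_bigr => i _; ring.
have L_dot a z : dotn n (L a) z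
    = \sum_i u 0 i * ((a == l i)%:R * z (h i) - (a == h i)%:R * z (l i)).
  rewrite /dotn; under eq_bigr => b _ do rewrite mulr_suml.
  rewrite exchange_big; apply: eq_bigr => i _ /=.
  have [lt_lh h_n _] := lhP i.
  rewrite -(sum_delta z h_n) -(sum_delta z (ltn_trans lt_lh h_n)).
  rewrite !mulr_sumr -sumrB mulr_sumr; apply: eq_bigr => b _; rewrite /l /h; ring.
have L_bilin y z : bilin n L y z
    = \sum_i u 0 i * (y (l i) * z (h i) - y (h i) * z (l i)).
  rewrite /bilin /dotn; under eq_bigr => a _ do rewrite -/(dotn _ _ _) L_dot mulr_suml.
  rewrite exchange_big; apply: eq_bigr => i _ /=.
  have [lt_lh h_n _] := lhP i.
  rewrite -(sum_delta y h_n) -(sum_delta y (ltn_trans lt_lh h_n)).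
  rewrite !mulr_suml -sumrB mulr_sumr; apply: eq_bigr => a _; rewrite /l /h; ring.
have L_edge (c d : 'I_n) : (c < d)%N -> [set c; d] \in G -> bilin n L (f c) (f d) = 0.
  move=> cd cdG; have /rowP/(_ (enum_rank [set c; d])) := uM0.
  rewrite !mxE L_bilin => uE; rewrite -[RHS]uE; apply: eq_bigr => i _.
  rewrite !mxE /= enum_rankK cdG /minor -/(l i) -/(h i).
  by rewrite /lo /hi elems_pair //= !xE [X in _ - X]mulrC [in RHS]mulrC; ring.
have L0 a b : L a b = 0.
  apply: f_form => // [{}a {}b ab|c d _ _ cdG].
    apply: big1 => i _; have [_ _] := lhP i; rewrite -/(l i) -/(h i) => lh_n.
    (* Pairs in B(n) have 1-based sum at most [n], so none contributes at [(a, b)] in either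
       order. *)
    have E1 : (b == h i) && (a == l i) = false by lia.
    have E2 : (b == l i) && (a == h i) = false by lia.
    by rewrite -!natrM !mulnb E1 E2 subrr mulr0.
  have [cd|dc|/val_inj cd] := ltngtP c d; first exact: L_edge.
    by rewrite bilinC // L_edge ?oppr0 // setUC.
  by move: (HG cdG); rewrite cd setUid cards1.
(* At [(l i, h i)] only the [i]-th term survives: a pair is determined by its two ends, and the
   swapped match contradicts [l < h]. *)
apply/rowP=> i; rewrite mxE -[RHS](L0 (l i) (h i)).
have [lt_lh _ _] := lhP i.
rewrite /L (bigD1 i) //= !eqxx big1 => [|k neq_ki].
  by rewrite (gtn_eqF lt_lh) (ltn_eqF lt_lh) !mulr1 addr0.
have E1 : (h i == h k) && (l i == l k) = false.
  apply: contraNF neq_ki => /andP[/eqP hE /eqP lE]; apply/eqP/enum_val_inj.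
  exact: lo_hi_inj (enum_valP _) (enum_valP _) (esym lE) (esym hE).
have [lt_lhk _ _] := lhP k.
have E2 : (h i == l k) && (l i == h k) = false.
  by apply/negbTE; move: lt_lh lt_lhk; rewrite -/(l i) -/(h i) -/(l k) -/(h k); lia.
by rewrite -!natrM !mulnb E1 E2 subrr mulr0.
Qed.

Lemma row_free_minors_generic : row_free (minors (xvar n)).
Proof.
have [x free_x] := row_free_minors_rat.
(* Quotient and remainder by [n] decode the index [i * n + j] of the variable in [xvar]. *)
have [phi phiE] := mpoly_eval_exists (n * n) (fun k => x (k %/ n)%N (k %% n)%N).
pose y a b : mpoly (n * n) := mvar (n * n) (a * n + b).
have -> : minors (xvar n) = map_mx (@FracField.tofrac _) (minors y).
  apply/matrixP=> i j; rewrite !mxE /=; case: ifP => _; last by rewrite rmorph0.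
  by rewrite /minor rmorphB !rmorphM.
apply: (@row_free_specialize _ _ phi).
suff -> : map_mx phi (minors y) = minors x by [].
apply/matrixP=> i j; rewrite !mxE /=.
case: (boolP (enum_val j \in G)) => [/HG/card2_ltn[c [d [cd ->]]]|_]; last exact: rmorph0.
have /BsetP[a [b [ab _ ->]]] := enum_valP i.
have yE (e f : 'I_n) : phi (y e f) = x e f.
  have [lt_en lt_fn] := (ltn_ord e, ltn_ord f).
  by rewrite phiE ?divnMDl ?modnMDl ?modn_small ?divn_small ?addn0 //; nia.
by rewrite /minor /lo /hi !elems_pair //= rmorphB !rmorphM !yE.
Qed.

End Generic.

(* Selection of B(n) by the shifting *)
Local Close Scope ring_scope.

Theorem mainTheorem4 (n : nat) (le : rel {set 'I_n})
  (Hto : term_order 2 le)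
  (Hsum : forall a b a' b' : 'I_n, (a < b)%N -> (a' < b')%N ->
            (a.+1 + b.+1 < a'.+1 + b'.+1)%N ->
            le [set a; b] [set a'; b'] && ([set a; b] != [set a'; b']))
  (G : {set {set 'I_n}})
  (HG : forall e, e \in G -> #|e| = 2)
  (H3 : forall T : {set 'I_n}, #|T| = 3 -> exists2 e, e \in G & e \subset T) :
  Bset n \subset ext_shift 2 le G.
Proof.
case: Hto => le_refl le_total le_anti le_trans _.
set s := sort le (ksubsets n 2).
have s_ksub S : (S \in s) = ksubset 2 S by rewrite mem_sort mem_filter mem_enum andbT.
have all_s : all (@ksubset n 2) s by apply/allP=> S; rewrite s_ksub.
(* Totality and transitivity of [le] are given on 2-subsets only, hence the sorting lemmas relative
   to a predicate. *)
have pair_s : pairwise le s.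
  rewrite -(@sorted_pairwise_in _ (ksubset 2)) //.
    apply: (@sort_sorted_in _ (ksubset 2)) => [S T|]; first exact: le_total.
    by apply/allP=> S; rewrite mem_filter => /andP[].
  by move=> T S U kT kS kU; apply: le_trans.
have uniq_s : uniq s by rewrite sort_uniq filter_uniq ?enum_uniq.
apply/subsetP=> S SB; rewrite inE.
have /BsetP[a [b [ab abn SE]]] := SB.
have Ss : S \in s by rewrite s_ksub /ksubset SE cards2 -val_eqE neq_ltn ab.
apply: (@foldl_select_mem _ (fun acc S => (crow 2 G S <= \sum_(T <- acc) <<crow 2 G T>>)%MS)) => //.
move=> acc sub_acc.
(* It remains to see that every set selected before [S] indexes another row of the independent
   family [minors]. *)
rewrite -{1}(enum_rankK_in SB SB) (crow_minors HG).
apply: row_free_sub_sum; first exact: row_free_minors_generic.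
apply/allP=> T /(mem_subseq sub_acc) T_before.
have Ts := mem_take T_before.
have sE : s = take (index S s) s ++ S :: drop (index S s).+1 s.
  by rewrite -{1}(cat_take_drop (index S s) s) drop_index.
have neq_TS : T != S.
  apply: contraTneq T_before => ->; move: uniq_s; rewrite {1}sE cat_uniq.
  by case/and3P=> _ /hasPn/(_ S (mem_head _ _)).
have le_TS : le T S.
  move: pair_s; rewrite {1}sE pairwise_cat => /andP[/allrelP le_all _].
  exact: le_all T_before (mem_head _ _).
rewrite s_ksub in Ts; rewrite s_ksub in Ss.
(* Otherwise the sum of [T] exceeds [n], hence that of [S], and [Hsum] puts [S] below [T];
   antisymmetry then gives [T = S]. *)
have TB : T \in Bset n.
  have [c [d [cd TE]]] := card2_ltn (eqP Ts).
  apply/BsetP; exists c, d; split=> //; rewrite leqNgt; apply: contra neq_TS => n_lt.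
  have /andP[le_ST _] := Hsum a b c d ab cd (leq_ltn_trans abn n_lt).
  by apply/eqP/le_anti => //; rewrite SE TE.
apply/existsP; exists (enum_rank_in SB T).
rewrite -crow_minors // enum_rankK_in // eqxx andbT.
by apply: contraNneq neq_TS => /(congr1 enum_val); rewrite !enum_rankK_in // => ->.
Qed.
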